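(* Let $G=(V,E)$ be a connected, locally finite chordal graph, left-handed with respect to a tree order $\preccurlyeq$, and let $\vec p\in[0,1]^V$. Shearer's law with marginal vector $\vec p$ exists (as an element of $G(\vec p)$) if and only if $\vec p\in\mathcal{P}^{=}_G$. Moreover, if $\vec c\in[0,1]^V$ is in equal correspondence with $\vec p$ and $(Y_v)_{v\in V}$ are independent Bernoulli random variables with $\mathbb{P}(Y_v=1)=c_v$, then the field $X$ defined by $X_v:=Y_v\prod_{w\in N^{\preccurlyeq}(v)}(1-Y_w)$ has Shearer's law with marginal vector $\vec p$.
   Context: A chordal graph is a loopless graph without multiple edges with no induced cycle of length greater than $3$. A tree order is a partial order $\preccurlyeq$ on $V$ such that $w\preccurlyeq u$ and $w\preccurlyeq v$ imply $u,v$ comparable; $G$ is left-handed w.r.t. it if (i) $uv\in E$ implies $u,v$ comparable and (ii) $w\preccurlyeq u\preccurlyeq v$, $vw\in E$ imply $uv\in E$. For $v\in V$, $N^{\preccurlyeq}(v):=\{w\in V: w\preccurlyeq v,\ vw\in E\}$. Vectors $\vec c,\vec p\in[0,1]^V$ are in equal correspondence if $p_v=c_v\prod_{w\in N^{\preccurlyeq}(v)}(1-c_w)$ for all $v$; $\mathcal{P}^{=}_G$ is the set of $\vec p$ for which such a $\vec c\in[0,1]^V$ exists. A Bernoulli random field (BRF) is a random element $X=(X_v)_{v\in V}$ of $\{0,1\}^V$; it is $1$-dependent if $X_U$ and $X_W$ are independent whenever $U,W\subseteq V$ have graph distance $d(U,W)>1$. $G(\vec p)$ is the set of laws of $1$-dependent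 BRFs with $\mathbb{P}(X_v=1)=p_v$ for all $v$. A BRF has Shearer's law with marginal vector $\vec p$ if for every finite $W\subseteq V$, $\mathbb{P}(X_w=0\ \forall w\in W)=\sum_{I}\prod_{w\in I}(-p_w)$, the sum running over all independent sets $I\subseteq W$ (sets containing no two adjacent vertices, including $\emptyset$). *)

(* Defs.v *)
From HB Require Import structures.
From mathcomp Require Export all_boot all_order all_algebra.
From mathcomp Require Export finmap.
From mathcomp Require Export all_classical all_reals all_analysis.
Set Implicit Arguments.
Unset Strict Implicit.
Unset Printing Implicit Defensive.
Import Order.TTheory GRing.Theory Num.Theory.
Local Open Scope classical_set_scope.
Local Open Scope ring_scope.

Section Graphs.
Context {V : choiceType}.
Implicit Types (E le : rel V) (U W : set V).

Definition simple_graph E := symmetric E /\ irreflexive E.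

Definition graph_connected E :=
  forall u v : V, exists2 s : seq V, path E u s & last u s = v.

Definition locally_finite_graph E := forall v : V, finite_set [set w | E v w].

(* The cycle is given by the cyclic sequence of its vertices; [induced] says
   that it has no chord. *)
Definition induced_cycle E (s : seq V) :=
  ucycle E s /\
  {in s &, forall x y, E x y -> y = next s x \/ x = next s y}.

Definition chordal E :=
  simple_graph E /\ forall s : seq V, induced_cycle E s -> (size s <= 3)%N.

Definition tree_order le :=
  [/\ reflexive le, antisymmetric le, transitive le &
      forall w u v, le w u -> le w v -> le u v || le v u].

(* The second condition is only meaningful for [u] distinct from [v]: for
   [u = v] it would turn every edge into a loop at its upper endpoint. *)
Definition left_handed E le :=
  (forall u v, E u v -> le u v || le v u) /\
  (forall w u v, le w u -> le u v -> u != v -> E v w -> E u v).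

Definition lower_nbrs E le (v : V) : set V := [set w | le w v && E v w].

Definition independent_set E (I : {fset V}) : bool :=
  allrel (fun x y => ~~ E x y) I I.

(* Length of a shortest path from [U] to [W], [+oo] if there is none. *)
Definition graph_dist (R : realType) E U W : \bar R :=
  ereal_inf [set ((size s)%:R%:E : \bar R) | s in
    [set s : seq V | exists u, [/\ U u, path E u s & W (last u s)]]].

Definition in_unit_cube (R : realType) (p : V -> R) :=
  forall v, 0 <= p v <= 1.

Definition equal_correspondence (R : realType) E le (c p : V -> R) :=
  forall v, p v = c v * \big[*%R/1]_(w \in lower_nbrs E le v) (1 - c w).

Definition equal_region (R : realType) E le : set (V -> R) :=
  [set p | in_unit_cube p /\
           exists c : V -> R, in_unit_cube c /\ equal_correspondence E le c p].

End Graphs.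

(* The space {0,1}^V, with [true] standing for 1, carries the product
   sigma-algebra; [<<s coord_events U >>] is the sub-sigma-algebra generated by
   the coordinates in [U]. *)
Definition coord_events (V : choiceType) (U : set V) : set (set (V -> bool)) :=
  [set A | exists2 v, U v & A = [set x : V -> bool | x v]].

Notation config V := (g_sigma_algebraType (coord_events [set: V])).

Section Fields.
Context {V : choiceType} {R : realType}.
Implicit Types (E le : rel V) (p : V -> R).
Local Open Scope ereal_scope.

(* Properties of a Bernoulli random field, expressed on its law [mu]. *)
Definition one_dependent E (mu : set (config V) -> \bar R) :=
  forall U W : set V, 1 < graph_dist R E U W ->
  forall A B, <<s coord_events U >> A -> <<s coord_events W >> B ->
  mu (A `&` B) = mu A * mu B.

Definition one_dependent_laws E p : set (probability (config V) R) :=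
  [set mu | one_dependent E mu /\ forall v, mu [set x | x v] = (p v)%:E].

Definition shearer_law E p (mu : set (config V) -> \bar R) :=
  forall W : {fset V},
  mu [set x | forall w, w \in W -> x w = false] =
  (\sum_(I <- fpowerset W | independent_set E I) \prod_(w <- I) - p w)%R%:E.

Definition mutually_independent d d' (T : measurableType d)
    (T' : measurableType d') (P : probability T R) (Y : V -> T -> T') :=
  forall (J : {fset V}) (B : V -> set T'), (forall v, measurable (B v)) ->
  P (\bigcap_(v in [set` J]) (Y v @^-1` B v)) =
  \prod_(v <- J) P (Y v @^-1` B v).

(* Y_v * prod_w (1 - Y_w): on bool, the product is [&&] and 1 - y is [~~ y]. *)
Definition field_of T E le (Y : V -> T -> bool) (t : T) : V -> bool :=
  fun v => Y v t && \big[andb/true]_(w \in lower_nbrs E le v) ~~ Y w t.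

End Fields.

(* Main.v *)
(* Write Q(W) for the sum over independent subsets I of W of prod_(w in I) -p_w.
   If c solves the correspondence on a finite set W then Q(W) = prod_W (1 - c):
   remove a maximal v and use Q(v + W) = Q(W) - p_v Q(W \ N(v)).  Conversely,
   Shearer's law forces Q >= 0, and this is exactly the bound on p_v needed to
   extend a solution from W to v + W; the solutions on finite sets are glued by
   compactness of [0,1]^V, since the order may have infinite descending chains.
   For the field X, left-handedness makes the sets {v} and N(v), v in S, disjoint
   when S is independent, so P(X = 1 on S) is prod_S p if S is independent and 0
   otherwise; Shearer's law and 1-dependence follow by inclusion-exclusion and
   by a pi-lambda argument. *)
Require Import Defs.
From mathcomp Require Import ring measurable_realfun.
Set Implicit Arguments.
Unset Strict Implicit.
Unset Printing Implicit Defensive.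
Import Order.TTheory GRing.Theory Num.Theory.
Import numFieldNormedType.Exports.
Local Open Scope classical_set_scope.
Local Open Scope ring_scope.

(** * Finite sets: splitting power sets and induction along a tree order *)

Section FiniteSets.
Context {V : choiceType}.
Implicit Types (v : V) (W T I : {fset V}).

Lemma big_fpowersetU1 (R : Type) (idx : R) (op : Monoid.com_law idx)
    (F : {fset V} -> R) v W : v \notin W ->
  \big[op/idx]_(I <- fpowerset (v |` W)%fset) F I =
  op (\big[op/idx]_(I <- fpowerset W) F I)
     (\big[op/idx]_(I <- fpowerset W) F (v |` I)%fset).
Proof.
move=> vW.
have nv I : I \in fpowerset W -> v \notin I.
  by rewrite fpowersetE => /fsubsetP IW; apply: contra vW => /IW.
rewrite -(big_map (fun I => v |` I)%fset predT) -big_cat /=.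
apply: perm_big; apply: uniq_perm.
- exact: fset_uniq.
- rewrite cat_uniq fset_uniq map_inj_in_uniq ?fset_uniq ?andbT /=.
    by apply/hasPn => _ /mapP[I _ ->]; apply/negP => /nv; rewrite !inE eqxx.
  by move=> I J /nv vI /nv vJ IJ; rewrite -(fsetU1K vI) IJ fsetU1K.
- move=> I; rewrite mem_cat !fpowersetE; apply/idP/orP.
    move=> IW; case: (boolP (v \in I)) => vI; last first.
      left; apply/fsubsetP => x xI; move/fsubsetP/(_ _ xI) : IW.
      by rewrite !inE => /orP[/eqP xv|//]; rewrite -xv xI in vI.
    right; apply/mapP; exists (I `\ v)%fset; last by rewrite fsetD1K.
    by rewrite fpowersetE fsubDset.
  case=> [IW|/mapP[J JW ->]].
    exact: (fsubset_trans IW (fsubsetUr _ _)).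
  by rewrite fsetUS// -fpowersetE.
Qed.

Lemma fset_maximal (le : rel V) W : tree_order le -> W != fset0 ->
  exists2 v, v \in W & forall u, u \in W -> u != v -> ~~ le v u.
Proof.
move=> [lexx lea letr _]; elim/finSet_rect: W => W IH W0.
have [v vW] : exists v, v \in W by exact/fset0Pn.
have [W'0|/(IH _ (fproperD1 vW))[m]] := eqVneq (W `\ v)%fset fset0.
  exists v => // u uW uv.
  suff : u \in (W `\ v)%fset by rewrite W'0.
  by rewrite !inE uv.
rewrite !inE => /andP[mv mW] mmax; have [mlev|mlev] := boolP (le m v).
  exists v => // u uW uv; apply/negP => vu.
  have [um|um] := eqVneq u m.
    by move: mv; rewrite (lea m v) ?eqxx// mlev -um.
  by have := mmax u; rewrite !inE uv um (letr _ _ _ mlev vu) => /(_ uW isT).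
exists m => // u uW um; have [->//|uv] := eqVneq u v.
by apply: mmax => //; rewrite !inE uv.
Qed.

(** The hypothesis covers all subsets of [W] because the recursion for Q at a maximal [v] involves
    both [W] and [W] without the neighbours of [v]. *)
Lemma fset_maximal_ind (le : rel V) (P : {fset V} -> Prop) : tree_order le ->
  P fset0 ->
  (forall v W, v \notin W -> (forall u, u \in W -> ~~ le v u) ->
    (forall T, (T `<=` W)%fset -> P T) -> P (v |` W)%fset) ->
  forall W, P W.
Proof.
move=> tle P0 PU; elim/finSet_rect => W IH.
have [->//|/(fset_maximal tle)[v vW vmax]] := eqVneq W fset0.
rewrite -(fsetD1K vW); apply: PU.
- by rewrite !inE eqxx.
- by move=> u; rewrite !inE => /andP[uv uW]; exact: vmax.
- by move=> T TW; apply: IH; exact: fsub_proper_trans TW (fproperD1 vW).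
Qed.

End FiniteSets.

(** * The independence polynomial Q and its deletion recursion *)

Section IndependencePolynomial.
Context {V : choiceType} {R : realType} (E : rel V).
Implicit Types (v : V) (W T I : {fset V}) (p : V -> R).

Definition indep_poly p W : R :=
  \sum_(I <- fpowerset W | independent_set E I) \prod_(w <- I) - p w.

Lemma independent_setU1 v I : symmetric E -> irreflexive E ->
  independent_set E (v |` I)%fset =
  independent_set E I && all (fun w => ~~ E v w) I.
Proof.
move=> Es Ei; apply/allrelP/andP.
  move=> h; split.
    by apply/allrelP => x y xI yI; apply: h; rewrite !inE ?xI ?yI orbT.
  by apply/allP => w wI; apply: h; rewrite !inE ?eqxx ?wI ?orbT.
case=> /allrelP h /allP hv x y; rewrite !inE.
move=> /orP[/eqP->|xI] /orP[/eqP->|yI]; first by rewrite Ei.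
- exact: hv.
- by rewrite Es; exact: hv.
- exact: h.
Qed.

Lemma indep_poly0 p : indep_poly p fset0 = 1.
Proof.
rewrite /indep_poly fpowerset0 big_mkcond big_seq_fset1.
rewrite [independent_set _ _](_ : _ = true) ?big_seq_fset0//. 
Qed.

(** An independent set containing [v] is [v] together with an independent set of non-neighbours of
    [v]; the others are independent subsets of [W]. *)
Lemma indep_polyU1 p v W : symmetric E -> irreflexive E -> v \notin W ->
  indep_poly p (v |` W)%fset =
  indep_poly p W - p v * indep_poly p [fset w in W | ~~ E v w]%fset.
Proof.
move=> Es Ei vW; rewrite /indep_poly big_mkcond big_fpowersetU1// -big_mkcond.
congr (_ + _); rewrite -mulNr big_distrr -big_mkcond /=.
apply: eq_fbig_cond => [I|I]; last first.
  rewrite fpowersetE => /fsubsetP IW _; rewrite big_fsetU1//.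
  by apply: contra vW => /IW.
rewrite !inE !fpowersetE independent_setU1// andbC [RHS]andbC -andbA.
congr (_ && _); rewrite andbC; apply/andP/fsubsetP.
  by move=> [/fsubsetP IW /allP Iv] w wI; rewrite !inE IW// Iv.
move=> IW; split; [apply/fsubsetP|apply/allP] => w /IW.
  by rewrite !inE => /andP[].
by rewrite !inE => /andP[].
Qed.

End IndependencePolynomial.

(** * Solving the correspondence on finite sets *)

Section FiniteCorrespondence.
Context {V : choiceType} {R : realType} (E le : rel V).
Hypotheses (Es : symmetric E) (Ei : irreflexive E).
Hypotheses (tle : tree_order le) (lh : left_handed E le).
Implicit Types (v : V) (W T I : {fset V}) (p c : V -> R).

(** Only lower neighbours inside [W] enter the product, so [W] may be any finite set, not just a
    downward closed one. *)
Definition correspondence_on W c p := forall v, v \in W ->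
  p v = c v * \prod_(w <- W | le w v && E v w) (1 - c w).

Lemma correspondence_onS W T c p : (T `<=` W)%fset ->
  (forall v w, v \in T -> w \in W -> le w v -> E v w -> w \in T) ->
  correspondence_on W c p -> correspondence_on T c p.
Proof.
move=> TW Tlow hW v vT; rewrite hW ?(fsubsetP TW)//; congr (_ * _).
apply: eq_fbigl_cond => w; rewrite !inE; apply/andP/andP.
  by move=> [wW /andP[wv vw]]; rewrite wv vw (Tlow v w).
by move=> [wT ->]; rewrite (fsubsetP TW).
Qed.

(** Removing N(v) changes no product: let [w] be a lower neighbour of a remaining [u], and suppose
    [w] is adjacent to [v]. Then [w] is below [v] by maximality, [u] and [v] are comparable as both
    lie above [w], so [u] is below [v], and left-handedness makes [u] and [v] adjacent, a
    contradiction. *)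
Lemma correspondence_on_nonnbrs v W c p : v \notin W ->
  (forall u, u \in W -> ~~ le v u) ->
  correspondence_on W c p ->
  correspondence_on [fset w in W | ~~ E v w]%fset c p.
Proof.
move=> vW vmax; apply: correspondence_onS.
  by apply/fsubsetP => w; rewrite !inE => /andP[].
move=> u w; rewrite !inE => /andP[uW vu] wW wu uw; rewrite wW/=.
apply: contra vu => vw; case: lh => cmp lh2; case: tle => _ _ _ tr.
have wv : le w v by have := cmp _ _ vw; rewrite (negbTE (vmax _ wW)).
have uv : le u v by have := tr _ _ _ wu wv; rewrite (negbTE (vmax _ uW)) orbF.
rewrite Es; apply: (lh2 w) => //.
by apply: contraNneq vW => <-.
Qed.

Lemma lower_nbrs_max v W w : (forall u, u \in W -> ~~ le v u) -> w \in W ->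
  le w v && E v w = E v w.
Proof.
move=> vmax wW; apply/andb_idl => vw.
by have := lh.1 _ _ vw; rewrite (negbTE (vmax _ wW)).
Qed.

Lemma indep_poly_correspondence W c p : correspondence_on W c p ->
  indep_poly E p W = \prod_(w <- W) (1 - c w).
Proof.
move: W; apply: (fset_maximal_ind tle) => [_|v W vW vmax IH hW].
  by rewrite indep_poly0 big_seq_fset0.
have hW' : correspondence_on W c p.
  apply: correspondence_onS hW; first exact: fsubsetUr.
  move=> u w uW; rewrite !inE => /orP[/eqP->|//] vu.
  by have := vmax _ uW; rewrite vu.
have subW : ([fset w in W | ~~ E v w] `<=` W)%fset.
  by apply/fsubsetP => w; rewrite !inE => /andP[].
rewrite indep_polyU1// !IH//; last exact: correspondence_on_nonnbrs.
(* Since [v] is maximal, all its neighbours in [W] are lower neighbours. *)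
have -> : p v = c v * \prod_(w <- W | E v w) (1 - c w).
  rewrite hW ?inE ?eqxx//; congr (_ * _).
  rewrite big_mkcond big_fsetU1//= Ei andbF mul1r -big_mkcond/=.
  apply: eq_fbigl_cond => w; rewrite !inE.
  by apply: andb_id2l => /(lower_nbrs_max vmax).
rewrite big_fsetU1// big_fset/=.
(* Splitting [W] into neighbours and non-neighbours of [v] shows that the subtracted term is [c v]
   times the full product over [W]. *)
by rewrite (bigID (E v))/=; ring.
Qed.

(* Sites outside N(v) with [c = 1] are discarded first, so that the common
   factor of Q(T) and Q(T \ N(v)) is positive. *)
Lemma le_prod_lower_nbrs p c v W : (forall T, 0 <= indep_poly E p T) ->
  in_unit_cube c -> (forall u, p u = 0 -> c u = 0) ->
  v \notin W -> (forall u, u \in W -> ~~ le v u) ->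
  correspondence_on W c p ->
  p v <= \prod_(w <- W | le w v && E v w) (1 - c w).
Proof.
move=> Qge0 c01 c0 vW vmax hW.
pose T := [fset x in W | E v x || (c x != 1)]%fset.
have TW : (T `<=` W)%fset by apply/fsubsetP => w; rewrite !inE => /andP[].
have hT : correspondence_on T c p.
  move=> u uT; have uW := fsubsetP TW _ uT.
  (* If a lower neighbour [w] of [u] was discarded, then [c w = 1] forces [p u = 0], hence [c u = 0]
     by [c0], and the equation at [u] survives as 0 = 0. Otherwise the product at [u] is
     unchanged. *)
  have [/hasP[w wW /and3P[wu uw wT]]|/hasPn none] :=
      boolP (has (fun w => [&& le w u, E u w & w \notin T]) W).
    have cw : c w = 1.
      by move: wT; rewrite !inE/= wW/= negb_or negbK => /andP[_ /eqP].
    have pu : p u = 0.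
      rewrite hW// big_mkcond (big_fsetD1 w)//= wu uw cw subrr.
      by rewrite mul0r mulr0.
    by rewrite c0// mul0r.
  rewrite hW//; congr (_ * _); apply: eq_fbigl_cond => w; rewrite !inE/= -andbA.
  apply: andb_id2l => wW; apply/idP/andP => [/andP[wu uw]|[_ //]].
  rewrite wu uw; split => //; have := none _ wW.
  by rewrite wu uw negbK !inE wW.
have vT : v \notin T by apply: contra vW => /(fsubsetP TW).
have vmaxT u : u \in T -> ~~ le v u by move/(fsubsetP TW); exact: vmax.
(* Q(v + T) factors as the product of [1 - c] over the non-neighbours in [T], which is positive,
   times the difference between the desired bound and [p v]. *)
have := Qge0 (v |` T)%fset.
rewrite indep_polyU1// !(@indep_poly_correspondence _ c)//; last first.
  exact: correspondence_on_nonnbrs.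
rewrite [X in _ - _ * X]big_fset (bigID (E v) predT)/=.
have -> : \prod_(w <- T | E v w) (1 - c w) =
          \prod_(w <- W | le w v && E v w) (1 - c w).
  apply: eq_fbigl_cond => w; rewrite !inE/= -andbA; apply: andb_id2l => wW.
  rewrite (lower_nbrs_max vmax wW). by case: (E v w); rewrite ?andbF.
rewrite -mulrBl pmulr_lge0 ?subr_ge0// big_seq_cond prodr_gt0// => w.
rewrite !inE => /andP[/andP[_ /orP[->//|cw] _]].
by rewrite subr_gt0 lt_neqAle cw; have /andP[] := c01 w.
Qed.

Lemma exists_correspondence_on p W : in_unit_cube p ->
  (forall T, 0 <= indep_poly E p T) ->
  exists c, in_unit_cube c /\ correspondence_on W c p.
Proof.
move=> p01 Qge0.
(* The induction also carries that [c] vanishes wherever [p] does, which [le_prod_lower_nbrs]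
   requires. *)
suff [c [c01 _ hc]] : exists c, [/\ in_unit_cube c,
    (forall u, p u = 0 -> c u = 0) & correspondence_on W c p] by exists c.
move: W; apply: (fset_maximal_ind tle) => [|v W vW vmax /(_ W (fsubset_refl W))].
  by exists (fun=> 0); split => // v; rewrite ?lexx ?ler01 ?inE.
move=> [c [c01 c0 hc]].
have := le_prod_lower_nbrs Qge0 c01 c0 vW vmax hc.
set B := \prod_(w <- _ | _) _ => pB.
have B0 : 0 <= B.
  by apply: prodr_ge0 => w _; rewrite subr_ge0; have /andP[] := c01 w.
(* If [B = 0] the quotient is 0 by convention; this still solves the equation at [v], since then
   [p v <= B] gives [p v = 0]. *)
pose c' u := if u == v then p v / B else c u.
have c'W Q : \prod_(w <- W | Q w) (1 - c' w) = \prod_(w <- W | Q w) (1 - c w).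
  by apply: eq_fbigr => w wW _; rewrite /c'; case: eqP => // wv; rewrite -wv wW in vW.
have /andP[pv0 _] := p01 v.
exists c'; split.
- move=> u; rewrite /c'; case: eqP => // _; rewrite divr_ge0//=.
  have [->|Bn0] := eqVneq B 0; first by rewrite invr0 mulr0.
  by rewrite ler_pdivrMr ?mul1r// lt_def Bn0.
- by move=> u pu0; rewrite /c'; case: eqP => [<-|_]; rewrite ?pu0 ?mul0r ?c0.
- move=> u; rewrite !inE => uvW; rewrite big_mkcond big_fsetU1//= -big_mkcond/=.
  rewrite c'W /c'; have [->|uv] := eqVneq u v.
    rewrite Ei andbF mul1r -/B; have [B00|Bn0] := eqVneq B 0.
      by apply/eqP; rewrite B00 mulr0 eq_le pv0 -B00 pB.
    by rewrite divfK.
  have uW : u \in W by case/orP: uvW => // /eqP /(elimN eqP uv).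
  (* For [u] in [W] the new factor is absent, as [v] is not below [u]. *)
  by rewrite (negbTE (vmax _ uW)) mul1r; exact: hc.
Qed.

End FiniteCorrespondence.

(** * Gluing finite solutions by compactness *)

Lemma ultra_fmap (T S : Type) (f : T -> S) (F : set_system T) :
  UltraFilter F -> UltraFilter (f @ F).
Proof.
move=> UF; split=> [|G PG FG]; first exact: fmap_proper_filter.
apply/seteqP; split=> // A GA; have [//|FA] := in_ultra_setVsetC (f @^-1` A) UF.
have GA' : G (~` A) by exact: FG.
by have /filter_ex[x []] : G (A `&` ~` A) by exact: filterI.
Qed.

Section Compactness.
Context {V : choiceType} {R : realType} (E le : rel V).

Lemma finite_lower_nbrs v : locally_finite_graph E ->
  finite_set (lower_nbrs E le v).
Proof. by move=> /(_ v); apply: sub_finite_set => w /andP[]. Qed.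

(* Solutions on the finite sets are glued along an ultrafilter on the directed
   set of finite subsets of V. *)
Lemma equal_region_of_finite p : locally_finite_graph E ->
  in_unit_cube p ->
  (forall W : {fset V}, exists c : V -> R,
     in_unit_cube c /\ correspondence_on E le W c p) ->
  equal_region E le p.
Proof.
move=> Efin p01 /choice[c hc].
pose above (W : {fset V}) := [set W' : {fset V} | (W `<=` W')%fset].
pose F := filter_from setT above.
have FF : ProperFilter F.
  apply: filter_from_proper => [|W _]; last by exists W; exact: fsubset_refl.
  apply: filter_from_filter; first by exists fset0.
  move=> W W' _ _; exists (W `|` W')%fset => // T /=.
  by rewrite /above/= fsubUset => /andP.
have [U [UU FU]] := ultraFilterLemma FF.
(* Each coordinate converges along [U] by compactness of [0,1]; no diagonal argument is needed. *)
have lim v : exists l : R, 0 <= l <= 1 /\ (fun W => c W v) @ U --> l.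
  have := @segment_compact R 0 1; rewrite compact_ultra.
  move=> /(_ _ (ultra_fmap (fun W => c W v) UU))[].
    apply: (@filterS _ U _ setT) filterT => W _ /=.
    by rewrite in_itv/=; exact: (hc W).1.
  by move=> l []; rewrite /= in_itv/= => l01 cl; exists l.
have [d hd] := choice lim.
split=> //; exists d; split => [v|v]; first exact: (hd v).1.
rewrite fsbig_finite/=; last exact: finite_lower_nbrs.
set N := fset_set _.
have cvgN (s : seq V) : (fun W => \prod_(w <- s) (1 - c W w)) @ U -->
    \prod_(w <- s) (1 - d w).
  elim: s => [|w s IH].
    by under eq_fun do rewrite big_nil; rewrite big_nil; exact: cvg_cst.
  under eq_fun do rewrite big_cons; rewrite big_cons.
  by apply: cvgM => //; apply: cvgB; [exact: cvg_cst|exact: (hd w).2].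
have cvgc : (fun W => c W v * \prod_(w <- N) (1 - c W w)) @ U -->
    d v * \prod_(w <- N) (1 - d w) by apply: cvgM => //; exact: (hd v).2.
(* Once [W] contains [v] and its finitely many lower neighbours, the equation on [W] at [v] is the
   full one, so the expression is eventually constant equal to [p v]. *)
have cvgp : (fun W => c W v * \prod_(w <- N) (1 - c W w)) @ U --> p v.
  apply: cvg_near_cst; apply: FU; exists (v |` N)%fset => // W /=.
  rewrite /above/= fsubUset fsub1set => /andP[vW /fsubsetP NW].
  have inN w : (w \in N) = le w v && E v w.
    rewrite in_fset_set; last exact: finite_lower_nbrs.
    by apply/idP/idP => [/set_mem/= /andP[-> ->]//|/andP[? ?]]; exact/mem_set/andP.
  rewrite (hc W).2//; congr (_ * _); apply: eq_fbigl_cond => w.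
  rewrite !inE /= andbT inN; apply/idP/andP => [wN|[]//].
  by split => //; rewrite NW// inN.
exact: (cvg_unique _ cvgp cvgc).
Qed.

Lemma indep_poly_ge0 p (mu : probability (config V) R) (W : {fset V}) :
  shearer_law E p mu -> 0 <= indep_poly E p W.
Proof.
by move=> /(_ W) h; rewrite -lee_fin /indep_poly -h measure_ge0.
Qed.
End Compactness.

(** * Independence of generated sigma-algebras *)

Section SigmaIndependence.
Context {d} {T : measurableType d} {R : realType} (P : probability T R).
Implicit Types (G H : set (set T)).

(** Both sides are finite measures in [A]: the restriction of [P] to [B], and [P] scaled by [P B].
    They agree on a pi-system containing the whole space, hence on what it generates. *)
Lemma g_sigma_algebra_indepl G B : setI_closed G -> G setT ->
  G `<=` measurable -> measurable B ->
  (forall A, G A -> P (A `&` B) = P A * P B)%E ->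
  forall A, <<s G >> A -> (P (A `&` B) = P A * P B)%E.
Proof.
move=> GI GT Gm mB GB A sA.
have PB0 : 0 <= fine (P B) by rewrite fine_ge0.
have scaleE C : mscale (NngNum PB0) P C = (P C * P B)%E.
  by rewrite /mscale/= fineK ?fin_num_measure// muleC.
rewrite -scaleE.
apply: (@g_sigma_algebra_measure_unique _ R T G Gm (fun=> setT) (fun=> GT) _
  (mrestr P mB) (mscale (NngNum PB0) P) GI _ _ A sA).
- by rewrite bigcup_const//; exists 0%N.
- by move=> C GC; exact: (etrans (GB _ GC) (esym (scaleE C))).
- move=> _; rewrite /mrestr (le_lt_trans (probability_le1 _ _)) ?ltry//.
  exact: measurableI.
Qed.

(** The one-sided lemma is applied twice: first to extend from [G] with an element of [H] fixed,
    then to extend from [H] with [A] fixed. *)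
Lemma g_sigma_algebra_indep G H : setI_closed G -> G setT -> G `<=` measurable ->
  setI_closed H -> H setT -> H `<=` measurable ->
  (forall A B, G A -> H B -> P (A `&` B) = P A * P B)%E ->
  forall A B, <<s G >> A -> <<s H >> B -> (P (A `&` B) = P A * P B)%E.
Proof.
move=> GI GT Gm HI HT Hm GH A B sA sB.
have mA : measurable A.
  exact: (smallest_sub (@sigma_algebra_measurable _ T) Gm).
rewrite setIC muleC; apply: (g_sigma_algebra_indepl HI HT Hm mA _ sB) => C HC.
rewrite setIC muleC.
by apply: (g_sigma_algebra_indepl GI GT Gm (Hm _ HC) _ sA) => D GD; exact: GH.
Qed.

End SigmaIndependence.

(** * Shearer's law and 1-dependence from the probabilities of all-ones events *)

Section LawsFromOnes.
Context {V : choiceType} {R : realType} (E : rel V) (p : V -> R).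
Implicit Types (S W I : {fset V}).

Definition all_ones S : set (config V) := [set x | forall v, v \in S -> x v].

Definition ones_zeros S W : set (config V) :=
  all_ones S `&` [set x | forall w, w \in W -> x w = false].

(** This is the mass Shearer's law gives to ones on [S]: adjacent sites are almost surely not both
    1, and pairwise nonadjacent sites are independent. *)
Definition ones_weight S : R :=
  if independent_set E S then \prod_(v <- S) p v else 0.

Lemma measurable_coord v : measurable ([set x | x v] : set (config V)).
Proof. by apply: sub_sigma_algebra; exists v. Qed.

Lemma all_onesU1 v S : all_ones (v |` S)%fset = all_ones S `&` [set x | x v].
Proof.
apply/seteqP; split=> x.
  by move=> h; split=> [w wS|]; apply: h; rewrite !inE ?wS ?orbT ?eqxx.
by move=> [h xv] w; rewrite !inE => /orP[/eqP->//|]; exact: h.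
Qed.

Lemma all_onesU S S' : all_ones (S `|` S')%fset = all_ones S `&` all_ones S'.
Proof.
apply/seteqP; split=> x.
  by move=> h; split=> w wS; apply: h; rewrite !inE wS ?orbT.
by move=> [h h'] w; rewrite !inE => /orP[]; [exact: h|exact: h'].
Qed.

Lemma all_ones0 : all_ones fset0 = setT.
Proof. by apply/seteqP; split. Qed.

Lemma measurable_all_ones S : measurable (all_ones S).
Proof.
elim/fset1U_rect : S => [|v S _ IH]; first by rewrite all_ones0.
by rewrite all_onesU1; apply: measurableI => //; exact: measurable_coord.
Qed.

Lemma ones_zerosU1r v S W :
  ones_zeros S (v |` W)%fset = ones_zeros S W `\` [set x | x v].
Proof.
apply/seteqP; split=> x.
  move=> [h1 h0]; split; last by rewrite /= h0// !inE eqxx.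
  by split => // w wW; rewrite h0// !inE wW orbT.
move=> [[h1 h0] /negP xv]; split => // w; rewrite !inE.
by move=> /orP[/eqP->|]; [exact/negbTE|exact: h0].
Qed.

Lemma ones_zeros0r S : ones_zeros S fset0 = all_ones S.
Proof. by apply/seteqP; split=> [x []|x h]. Qed.

Lemma measurable_ones_zeros S W : measurable (ones_zeros S W).
Proof.
elim/fset1U_rect : W => [|v W _ IH].
  by rewrite ones_zeros0r; exact: measurable_all_ones.
by rewrite ones_zerosU1r; apply: measurableD => //; exact: measurable_coord.
Qed.

Variable mu : probability (config V) R.
Hypothesis mu_ones : forall S, mu (all_ones S) = (ones_weight S)%:E.

(* Inclusion-exclusion over the sites required to vanish. *)
Lemma measure_ones_zeros S W : mu (ones_zeros S W) =
  (\sum_(I <- fpowerset W) (\prod_(w <- I) -1) * ones_weight (S `|` I)%fset)%:E.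
Proof.
elim/fset1U_rect : W S => [S|v W vW IH S].
  by rewrite ones_zeros0r mu_ones fpowerset0 big_seq_fset1 big_seq_fset0 mul1r fsetU0.
have -> : mu (ones_zeros S (v |` W)%fset) =
    (mu (ones_zeros S W) - mu (ones_zeros (v |` S)%fset W))%E.
  have -> : ones_zeros (v |` S)%fset W = ones_zeros S W `&` [set x | x v].
    by rewrite /ones_zeros all_onesU1 setIAC.
  rewrite ones_zerosU1r; apply: measureD.
  - exact: measurable_ones_zeros.
  - exact: measurable_coord.
  - rewrite (le_lt_trans (probability_le1 _ _)) ?ltry//.
    exact: measurable_ones_zeros.
(* The subtracted event collects the terms whose index set contains [v]; its sign is the factor -1
   of [v]. *)
rewrite !IH -EFinB big_fpowersetU1// -sumrN; congr (_ + _)%:E.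
apply: eq_fbigr => I; rewrite fpowersetE => /fsubsetP IW _.
rewrite big_fsetU1/=; last by apply: contra vW => /IW.
by rewrite fsetUCA fsetUA mulN1r mulNr.
Qed.

Lemma shearer_law_of_ones : shearer_law E p mu.
Proof.
move=> W; have := measure_ones_zeros fset0 W.
rewrite /ones_zeros all_ones0 setTI => ->; rewrite [in RHS]big_mkcond.
congr (_%:E); apply: eq_bigr => I _.
rewrite fset0U /ones_weight; case: ifP => _; last by rewrite mulr0.
by rewrite -big_split/=; apply: eq_bigr => w _; rewrite mulN1r.
Qed.

(** A common vertex gives a path with no edge, and an edge gives a path with one edge; either bounds
    the distance by 1. *)
Lemma graph_dist_gt1 (U W : set V) u w : (1 < graph_dist R E U W)%E ->
  U u -> W w -> u != w /\ ~~ E u w.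
Proof.
move=> dUW Uu Ww; split; apply/negP => h.
  move: dUW; apply/negP; rewrite -leNgt.
  apply: (@le_trans _ _ (0%:E)); last by rewrite lee_fin.
  apply: ereal_inf_lbound; exists [::] => //; exists u; split => //=.
  by rewrite (eqP h).
move: dUW; apply/negP; rewrite -leNgt.
by apply: ereal_inf_lbound; exists [:: w] => //; exists u; split => //=; rewrite h.
Qed.

(** The events [all_ones S] with [S] finite inside [U] form a pi-system generating the coordinates
    in [U]. For sets at distance above 1, [S] and [S'] are disjoint with no edge between them, so
    [ones_weight] is multiplicative. *)
Lemma one_dependent_of_ones : symmetric E -> one_dependent E mu.
Proof.
move=> Es U W dUW.
pose G (U' : set V) := [set all_ones S | S in [set S : {fset V} | [set` S] `<=` U']].
have GI U' : setI_closed (G U').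
  move=> _ _ [S SU <-] [S' SU' <-]; exists (S `|` S')%fset.
    by move=> v /=; rewrite !inE => /orP[/SU|/SU'].
  by rewrite all_onesU.
have GT U' : G U' setT by exists fset0; [move=> v; rewrite /= inE|exact: all_ones0].
have Gm U' : G U' `<=` measurable by move=> _ [S _ <-]; exact: measurable_all_ones.
have sG U' : <<s coord_events U' >> `<=` <<s G U' >>.
  apply: sub_sigma_algebra2 => _ [v U'v ->].
  exists [fset v]%fset; first by move=> w /=; rewrite !inE => /eqP->.
  by rewrite -(fsetU0 [fset v]%fset) all_onesU1 all_ones0 setTI.
move=> A B /sG sA /sG sB.
apply: (g_sigma_algebra_indep (GI _) (GT _) (Gm _) (GI _) (GT _) (Gm _) _ sA sB).
move=> _ _ [S SU <-] [S' SW <-]; rewrite -all_onesU !mu_ones -EFinM.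
have sep u w : u \in S -> w \in S' -> u != w /\ ~~ E u w.
  by move=> /SU Uu /SW Ww; exact: graph_dist_gt1 dUW Uu Ww.
congr (_%:E); rewrite /ones_weight.
have -> : independent_set E (S `|` S')%fset =
          independent_set E S && independent_set E S'.
  apply/allrelP/andP => [h|[/allrelP h /allrelP h'] x y].
    by split; apply/allrelP => x y xS yS; apply: h; rewrite !inE ?xS ?yS ?orbT.
  rewrite !inE => /orP[xS|xS] /orP[yS|yS].
  - exact: h.
  - exact: (sep _ _ xS yS).2.
  - by rewrite Es; exact: (sep _ _ yS xS).2.
  - exact: h'.
case: ifP => [/andP[-> ->]|]; last first.
  by do 2 case: ifP => //; rewrite ?mulr0 ?mul0r.
rewrite (big_fsetID _ (mem S))/=; congr (_ * _).
  apply: eq_fbigl => x; rewrite !inE andb_orl andbb.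
  by case: (x \in S) => //=; rewrite andbF.
apply: eq_fbigl => x; rewrite !inE andb_orl andbN /=.
by apply/andb_idr => xS'; apply/negP => xS; have [] := sep _ _ xS xS'; rewrite eqxx.
Qed.

End LawsFromOnes.

(** * The field X built from independent bits *)

Section FieldOf.
Context {V : choiceType} {R : realType} (E le : rel V).
Hypotheses (Es : symmetric E).
Hypotheses (Efin : locally_finite_graph E).
Hypotheses (tle : tree_order le) (lh : left_handed E le).
Context {d} {T : measurableType d} (P : probability T R).
Variable Y : V -> {mfun T >-> bool}.

Let L v : {fset V} := fset_set (lower_nbrs E le v).

Let X : T -> config V := field_of E le (fun v => Y v : T -> bool).

Lemma in_lower_fset v w : (w \in L v) = le w v && E v w.
Proof.
rewrite in_fset_set; last exact: finite_lower_nbrs.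
by apply/idP/idP => [/set_mem|h]; last exact/mem_set.
Qed.

Lemma field_ofE t v : X t v = Y v t && all (fun w => ~~ Y w t) (L v).
Proof.
rewrite /X /field_of fsbig_finite/=; last exact: finite_lower_nbrs.
by rewrite big_all.
Qed.

Lemma measurable_field_of : measurable_fun [set: T] X.
Proof.
apply: (@measurability _ _ T (config V) setT X (coord_events [set: V])) => //.
move=> _ [_ [v _ ->] <-]; rewrite setTI.
have mY w : measurable [set t | Y w t] by exact: measurable_funPTI (Y w) [set true] _.
rewrite (_ : _ @^-1` _ =
    [set t | Y v t] `&` \bigcap_(w in [set` L v]) ~` [set t | Y w t]).
  apply: measurableI => //; apply: fin_bigcap_measurable => // w _.
  exact: measurableC.
apply/seteqP; split=> t /=; rewrite field_ofE.
  by move=> /andP[-> /allP h]; split => // w /h /negP.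
by move=> [-> h]; apply/allP => w /h /negP.
Qed.

Hypothesis Yind : mutually_independent P (fun v => Y v : T -> bool).
Variables c p : V -> R.
Hypothesis Yc : forall v, P [set t | Y v t] = (c v)%:E.
Hypothesis cp : equal_correspondence E le c p.

Lemma probability_indep_bits (S Z : {fset V}) : [disjoint S & Z]%fset ->
  P [set t | (forall v, v \in S -> Y v t) /\ (forall w, w \in Z -> ~~ Y w t)] =
  ((\prod_(v <- S) c v) * \prod_(w <- Z) (1 - c w))%:E.
Proof.
(* Only the values of [B] on the union of [S] and [Z] matter, so the default [[set false]] serves
   for all of [Z]. *)
move=> SZ; pose B v := if v \in S then [set true] else [set false].
have nS w : w \in Z -> (w \in S) = false.
  by move=> wZ; apply/negbTE; apply: contraL wZ => /(fdisjointP SZ).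
have := Yind (S `|` Z)%fset (B := B); rewrite (_ : \bigcap_(_ in _) _ =
    [set t | (forall v, v \in S -> Y v t) /\ (forall w, w \in Z -> ~~ Y w t)]);
    last first.
  apply/seteqP; split=> t.
    move=> h; split=> v vS; have := h v; rewrite /= !inE vS ?orbT /B.
      by move=> /(_ isT); rewrite vS.
    by move=> /(_ isT); rewrite nS// => ->.
  move=> [h1 h0] v; rewrite /= !inE /B; case: ifP => [vS _|_ /= /h0 /negbTE//].
  exact: h1.
move=> ->; last by move=> v; rewrite /B; case: ifP.
have PB v : P (Y v @^-1` B v) = (if v \in S then c v else 1 - c v)%:E.
  have e1 : Y v @^-1` [set true] = [set t | Y v t] by apply/seteqP; split.
  rewrite /B; case: ifP => _; first by rewrite e1 Yc.
  rewrite (_ : _ @^-1` _ = ~` (Y v @^-1` [set true])).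
    by rewrite probability_setC ?e1 ?Yc// -e1; exact: measurable_funPTI.
  by apply/seteqP; split=> t /=; case: (Y v t).
rewrite (eq_bigr _ (fun v _ => PB v)).
rewrite prodEFin (big_fsetID _ (mem S))/=; congr (_ * _)%:E.
  apply: eq_fbig => x; rewrite !inE; last by move=> /andP[_ ->].
  by rewrite andb_orl andbb; case: (x \in S) => //=; rewrite andbF.
apply: eq_fbig => x; rewrite !inE; last by move=> /andP[_ /negbTE ->].
by rewrite andb_orl andbN /=; apply: andb_idr => /nS ->.
Qed.

(** A common lower neighbour would make [v] and [w] comparable by the tree order, hence adjacent by
    left-handedness. *)
Lemma lower_fset_disjoint v w : ~~ E v w -> v != w -> [disjoint L v & L w]%fset.
Proof.
move=> vw v'w; apply/fdisjointP => z; rewrite in_lower_fset => /andP[zv vz].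
apply/negP; rewrite in_lower_fset => /andP[zw wz].
have [cmp lh2] := lh; have [_ _ _ tr] := tle.
have /orP[vlw|wlv] := tr _ _ _ zv zw.
  by move: vw; rewrite (lh2 z v w).
by move: vw; rewrite Es (lh2 z w v)// eq_sym.
Qed.

Lemma probability_field_ones (S : {fset V}) :
  P [set t | forall v, v \in S -> X t v] = (ones_weight E p S)%:E.
Proof.
rewrite /ones_weight; case: (boolP (independent_set E S)) => [/allrelP indS|nind].
  (* For independent [S], the event is that [Y] is 1 on [S] and 0 on the union of the [L v]. This
     union avoids [S] and is itself disjoint, so the probability regroups into factors [p v]. *)
  have SZ : [disjoint S & \bigcup_(v <- S) L v]%fset.
    apply/fdisjointP => w wS; apply/negP => /bigfcupP[v].
    by rewrite andbT => vS; rewrite in_lower_fset => /andP[_]; apply/negP/indS.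
  have := probability_indep_bits SZ.
  rewrite partition_disjoint_bigfcup; last first.
    by move=> v w vS wS; apply: lower_fset_disjoint; exact: indS.
  rewrite -big_split/= (eq_bigr p); last first.
    move=> v _; rewrite cp fsbig_finite//; exact: finite_lower_nbrs.
  move=> <-; congr (P _); apply/seteqP; split=> t /=.
    move=> h; split=> v.
      by move=> vS; have := h v vS; rewrite field_ofE => /andP[].
    move=> /bigfcupP[w]; rewrite andbT => wS vw.
    by have := h w wS; rewrite field_ofE => /andP[_ /allP]; exact.
  move=> [h1 h0] v vS; rewrite field_ofE h1//=; apply/allP => w wL.
  by apply: h0; apply/bigfcupP; exists v => //; rewrite andbT.
(* For adjacent [x] below [y], a one of [X] at [y] forces [Y x] to be 0, while a one at [x] forces
   it to be 1. *)
have [x [y [xS yS Exy xy]]] : exists x y, [/\ x \in S, y \in S, E x y & le x y].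
  have [/hasP[x xS /hasP[y yS Exy]]|/hasPn h] :=
      boolP (has (fun x => has (E x) S) S).
    have /orP[xy|yx] := lh.1 _ _ Exy; first by exists x, y.
    by exists y, x; split => //; rewrite Es.
  case/negP: nind; apply/allrelP => x y xS yS.
  by have /hasPn := h x xS; exact.
rewrite (_ : [set t | _] = set0) ?measure0//; apply/seteqP; split=> // t h.
have := h x xS; have := h y yS; rewrite !field_ofE => /andP[_ /allP hy] /andP[Yx _].
by have := hy x; rewrite in_lower_fset xy Es Exy Yx => /(_ isT).
Qed.

(** Packages the pushforward as a probability, for use both in the existence claim and in the claim
    about X. *)
Lemma law_of_field : exists mu : probability (config V) R,
  (mu : set (config V) -> \bar R) = pushforward P X /\
  forall S, mu (all_ones S) = (ones_weight E p S)%:E.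
Proof.
pose X' := mfun_Sub (mem_set measurable_field_of : X \in mfun).
exists (distribution P X'); split; first by [].
by move=> S; rewrite -probability_field_ones.
Qed.

End FieldOf.

(** * Independent Bernoulli variables as generalised digits of a uniform point *)

Section BernoulliSequence.
Context {R : realType}.
Implicit Types (q : nat -> R) (a l x : R) (B : nat -> set bool).

(* [`[a, a + l[] is split at [a + q 0 * l]; the first digit of [x] tells in
   which part [x] falls, the next ones are its digits in that part. *)
Fixpoint digit q n a l x : bool :=
  if n is m.+1 then
    if x < a + q 0%N * l then digit (q \o S) m a (q 0%N * l) x
    else digit (q \o S) m (a + q 0%N * l) ((1 - q 0%N) * l) x
  else x < a + q 0%N * l.

Lemma measurable_digit q n a l :
  measurable_fun [set: measurableTypeR R] (digit q n a l).
Proof.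
elim: n q a l => [|n IH] q a l /=; first exact: measurable_fun_ltr.
by apply: measurable_fun_ifT => //; exact: measurable_fun_ltr.
Qed.

Definition digit_cell q n a l B : set (measurableTypeR R) :=
  [set x | (a <= x < a + l) /\ (forall i, (i < n)%N -> B i (digit q i a l x))].

(** The mass of [A] under the Bernoulli law with parameter [r]. *)
Definition bernoulli_weight r (A : set bool) : R :=
  r * (true \in A)%:R + (1 - r) * (false \in A)%:R.

Lemma measurable_digit_cell q n a l B : measurable (digit_cell q n a l B).
Proof.
rewrite (_ : digit_cell _ _ _ _ _ =
    `[a, a + l[%classic `&` \bigcap_(i < n) (digit q i a l @^-1` B i)).
  apply: measurableI; first exact: measurable_itv.
  apply: fin_bigcap_measurable => // i _; rewrite -[X in measurable X]setTI.
  exact: measurable_digit.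
by apply/seteqP; split=> x [? h]; split => // i /h.
Qed.

Let P := uniform_prob (@ltr01 R).

Lemma uniform_prob01_itv a b : 0 <= a -> a <= b -> b <= 1 ->
  P `[a, b[%classic = (b - a)%:E.
Proof.
move=> a0 ab b1; rewrite /P /uniform_prob integral_uniform_pdf setIidl; last first.
  move=> x /=; rewrite !in_itv/= => /andP[ax xb].
  by rewrite (le_trans a0 ax) (le_trans (ltW xb) b1).
rewrite (eq_integral (fun=> 1%:E)); last first.
  move=> x; rewrite inE/= in_itv/= => /andP[ax xb].
  by rewrite /uniform_pdf (le_trans a0 ax) (le_trans (ltW xb) b1) subr0 invr1.
rewrite integral_cst//= mul1e lebesgue_measure_itv/= lte_fin.
move: ab; rewrite le_eqVlt => /orP[/eqP->|->]; last by rewrite EFinB.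
by rewrite ltxx subrr.
Qed.

(** Self-similarity: in the left part the first digit is [true], and the later digits are the digits
    relative to that part with shifted parameters. [digit_cellSC] treats the right part. *)
Lemma digit_cellS q n a l B : 0 <= q 0%N <= 1 -> 0 <= l ->
  digit_cell q n.+1 a l B `&` [set x | x < a + q 0%N * l] =
  (if true \in B 0%N then digit_cell (q \o S) n a (q 0%N * l) (B \o S) else set0).
Proof.
move=> /andP[q0 q1] l0; apply/seteqP; split=> x /=.
  move=> [[/andP[ax xl] h] xk].
  rewrite ifT; last by apply/mem_set; have := h 0%N; rewrite /= xk; exact.
  split; first by rewrite ax xk.
  by move=> i ilt; have := h i.+1 ilt; rewrite /= xk.
case: ifP => // /set_mem B0 [/andP[ax xk] h].
split=> //; split.
  rewrite ax (lt_le_trans xk)// lerD2l ler_piMl//.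
by move=> [_|i ilt] /=; rewrite xk//; exact: h.
Qed.

Lemma digit_cellSC q n a l B : 0 <= q 0%N <= 1 -> 0 <= l ->
  digit_cell q n.+1 a l B `\` [set x | x < a + q 0%N * l] =
  (if false \in B 0%N then
     digit_cell (q \o S) n (a + q 0%N * l) ((1 - q 0%N) * l) (B \o S) else set0).
Proof.
move=> /andP[q0 q1] l0; apply/seteqP; split=> x /=.
  move=> [[/andP[ax xl] h] /negP xk].
  rewrite ifT; last by apply/mem_set; have := h 0%N; rewrite /= (negbTE xk); exact.
  split; last by move=> i ilt; have := h i.+1 ilt; rewrite /= (negbTE xk).
  rewrite leNgt xk (_ : a + _ + _ = a + l)//; ring.
case: ifP => // /set_mem B0 [/andP[kx xl] h].
have xk : (x < a + q 0%N * l) = false by rewrite ltNge kx.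
split; last by rewrite xk.
split.
  rewrite (le_trans _ kx) ?lerDl ?mulr_ge0//=.
  by rewrite (_ : a + l = a + q 0%N * l + (1 - q 0%N) * l)//; ring.
by move=> [_|i ilt] /=; rewrite xk//; exact: h.
Qed.

(** Induction on [n] for all intervals at once: the two parts have lengths [q 0 * l] and
    [(1 - q 0) * l], and adding their masses produces the weight of the first digit. *)
Lemma probability_digit_cell q n a l B : (forall i, 0 <= q i <= 1) ->
  0 <= a -> 0 <= l -> a + l <= 1 ->
  P (digit_cell q n a l B) =
  (l * \prod_(i < n) bernoulli_weight (q i) (B i))%:E.
Proof.
elim: n q a l B => [|n IH] q a l B q01 a0 l0 al1.
  rewrite big_ord0 mulr1 (_ : digit_cell _ _ _ _ _ = `[a, a + l[%classic).
    by rewrite uniform_prob01_itv// ?lerDl//; congr (_%:E); ring.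
  by apply/seteqP; split=> x => [[]|].
have /andP[q0 q1] := q01 0%N.
have mK : measurable ([set x | x < a + q 0%N * l] : set (measurableTypeR R)).
  rewrite (_ : [set x | _] = `]-oo, (a + q 0%N * l)[%classic).
    exact: measurable_itv.
  by apply/seteqP; split=> x /=; rewrite in_itv.
have ql : 0 <= q 0%N * l by rewrite mulr_ge0.
have ql' : 0 <= (1 - q 0%N) * l by rewrite mulr_ge0// subr_ge0.
have qll : q 0%N * l + (1 - q 0%N) * l = l by ring.
transitivity (P (digit_cell q n.+1 a l B `\` [set x | (x < a + q 0%N * l)%R]) +
              P (digit_cell q n.+1 a l B `&` [set x | (x < a + q 0%N * l)%R]))%E.
  by apply: measureDI => //; exact: measurable_digit_cell.
have P0 : P set0 = 0%E by exact: measure0.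
rewrite digit_cellS// digit_cellSC// big_ord_recl.
pose W := \prod_(i < n) bernoulli_weight (q i.+1) (B i.+1).
set W' := (X in (l * (_ * X))%:E).
have -> : W' = W by [].
have -> : P (if true \in B 0%N
    then digit_cell (q \o S) n a (q 0%N * l) (B \o S) else set0) =
    (q 0%N * l * (true \in B 0%N)%:R * W)%:E.
  case: ifP => _; last by rewrite P0 mulr0 mul0r.
  rewrite mulr1 IH//; first by move=> i; exact: q01.
  by rewrite (le_trans _ al1)// lerD2l -[leRHS]qll lerDl.
have -> : P (if false \in B 0%N
    then digit_cell (q \o S) n (a + q 0%N * l) ((1 - q 0%N) * l) (B \o S)
    else set0) =
    ((1 - q 0%N) * l * (false \in B 0%N)%:R * W)%:E.
  case: ifP => _; last by rewrite P0 mulr0 mul0r.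
  rewrite mulr1 IH//; first by move=> i; exact: q01.
  - by rewrite addr_ge0.
  - by rewrite -addrA qll.
by rewrite -EFinD; congr (_%:E); rewrite /bernoulli_weight; ring.
Qed.

Lemma probability_digits q (J : {fset nat}) B : (forall i, 0 <= q i <= 1) ->
  P (\bigcap_(i in [set` J]) (digit q i 0 1 @^-1` B i)) =
  (\prod_(i <- J) bernoulli_weight (q i) (B i))%:E.
Proof.
move=> q01; set A := \bigcap_(_ in _) _.
have mA : measurable A.
  apply: fin_bigcap_measurable => // i _; rewrite -[X in measurable X]setTI.
  exact: measurable_digit.
pose n := (\max_(i <- J) i).+1.
have Jn i : i \in J -> (i < n)%N.
  by move=> iJ; rewrite ltnS; exact: leq_bigmax_seq.
(* Digits below [n] outside [J] are left free, and [[set: bool]] has weight 1. *)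
pose B' i := if i \in J then B i else setT.
have : P A = P (digit_cell q n 0 1 B').
  (* Cells live in the half-open unit interval, whose complement is null for the uniform law. *)
  pose I01 : set (measurableTypeR R) := `[0, 1[%classic.
  have mI : measurable I01 by exact: measurable_itv.
  have PI : P (~` I01) = 0%E.
    transitivity (1 - P I01)%E; first exact: probability_setC.
    by rewrite uniform_prob01_itv// ?ler01// subr0 subee.
  transitivity (P (A `\` I01) + P (A `&` I01))%E; first exact: measureDI.
  rewrite [X in (X + _)%E](_ : _ = 0%E); last first.
    apply: (@subset_measure0 _ _ _ P _ (~` I01)) => //.
    - exact: measurableD.
    - exact: measurableC.
  rewrite add0e; congr (P _); apply/seteqP; split=> x.
    move=> [Ax x01]; split; first by rewrite add0r.
    by move=> i _; rewrite /B'; case: ifP => // iJ; exact: Ax.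
  move=> [x01 h]; split; last by rewrite add0r in x01.
  by move=> i iJ; have := h i (Jn _ iJ); rewrite /B' iJ.
rewrite probability_digit_cell// ?ler01 ?add0r// mul1r => ->; congr (_%:E).
rewrite -(big_mkord xpredT (fun i => bernoulli_weight (q i) (B' i))).
have -> : \prod_(i <- J) bernoulli_weight (q i) (B i) =
    \prod_(i <- J) bernoulli_weight (q i) (B' i).
  by apply: eq_fbigr => i iJ _; rewrite /B' iJ.
rewrite (bigID (mem J))/= [X in _ * X]big1 ?mulr1; last first.
  move=> i /negbTE iJ.
  by rewrite /B' iJ /bernoulli_weight !in_setT /= !mulr1 addrC subrK.
rewrite -big_filter; apply: perm_big; apply: uniq_perm.
- by rewrite filter_uniq// iota_uniq.
- exact: fset_uniq.
- move=> i; rewrite mem_filter mem_iota subn0 add0n /=.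
  by apply/andb_idr => /Jn.
Qed.

End BernoulliSequence.

Lemma exists_independent_bits (R : realType) (V : choiceType) (c : V -> R) :
  countable [set: V] -> in_unit_cube c ->
  exists (d : measure_display) (T : measurableType d) (P : probability T R)
      (Y : V -> {mfun T >-> bool}),
    mutually_independent P (fun v => Y v : T -> bool) /\
    forall v, P [set t | Y v t] = (c v)%:E.
Proof.
move=> /pcard_injP[f finj] c01.
(* [g] is a partial inverse of the injection [f]: vertex [v] receives digit number [f v], and
   indices outside the image of [f] get the parameter 0. *)
have /choice[g gP] : forall i, exists o : option V, forall v, f v = i -> o = Some v.
  move=> i; have [[v <-]|none] := pselect (exists v, f v = i).
    by exists (Some v) => w fwv; rewrite (finj w v)// ?inE.
  by exists None => v fv; case: none; exists v.
have gf v : g (f v) = Some v by exact: gP.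
pose q i := oapp c 0 (g i).
have q01 i : 0 <= q i <= 1.
  by rewrite /q; case: (g i) => [v|] //=; rewrite lexx ler01.
have qf v : q (f v) = c v by rewrite /q gf.
pose P : probability (measurableTypeR R) R := uniform_prob (@ltr01 R).
pose Y v : {mfun measurableTypeR R >-> bool} :=
  @mfun_Sub _ _ (measurableTypeR R) _ _ (mem_set (measurable_digit q (f v) 0 1)).
have PJ (J : {fset V}) (B : V -> set bool) :
    P (\bigcap_(v in [set` J]) (Y v @^-1` B v)) =
    (\prod_(v <- J) bernoulli_weight (c v) (B v))%:E.
  pose B' i := oapp B setT (g i).
  transitivity (P (\bigcap_(i in [set` [fset f v | v in J]%fset])
                     (digit q i 0 1 @^-1` B' i))).
    congr (P _); apply/seteqP; split=> x h.
      by move=> _ /= /imfsetP[v vJ ->]; rewrite /B' gf; exact: h.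
    move=> v vJ; have := h (f v); rewrite /B' gf; apply.
    by apply/imfsetP; exists v.
  rewrite [LHS](probability_digits _ _ q01) big_imfset/=; last first.
    by move=> v w _ _; apply: finj; rewrite inE.
  by congr (_%:E); apply: eq_bigr => v _; rewrite qf /B' gf.
have P1 v (A : set bool) : P (Y v @^-1` A) = (bernoulli_weight (c v) A)%:E.
  have := PJ [fset v]%fset (fun=> A); rewrite big_seq_fset1 => <-.
  congr (P _); apply/seteqP; split=> x h; first by move=> w /=; rewrite inE => /eqP->.
  by apply: h; rewrite /= inE.
exists _, (measurableTypeR R), P, Y; split.
  by move=> J B _; rewrite PJ -prodEFin; apply: eq_bigr => v _; rewrite P1.
move=> v; have := P1 v [set true].
rewrite /bernoulli_weight mem_set// memNset// mulr1 mulr0 addr0 => <-.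
by congr (P _); apply/seteqP; split.
Qed.

(** * Countability of the vertex set and conclusion *)

Lemma countable_vertices (V : choiceType) (E : rel V) :
  graph_connected E -> locally_finite_graph E -> countable [set: V].
Proof.
move=> conn fin; have [[v0 _]|V0] := pselect ([set: V] !=set0); last first.
  by rewrite (_ : [set: V] = set0)//; apply/seteqP; split=> // v _; case: V0; exists v.
(* [ball n] holds the endpoints of walks with exactly [n] steps from [v0]; it is finite by local
   finiteness, and by connectedness these sets cover [V]. *)
pose ball := fix ball n : set V :=
  if n is m.+1 then \bigcup_(v in ball m) [set w | E v w] else [set v0].
have finb n : finite_set (ball n).
  by elim: n => [|n IH] /=; [exact: finite_set1|exact: bigcup_finite].
have inb s : forall n v, ball n v -> path E v s -> ball (n + size s)%N (last v s).
  elim: s => [|w s IH] n v bv /=; first by rewrite addn0.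
  by move=> /andP[vw]; rewrite -addSnnS; apply: IH; exists v.
apply: (@sub_countable _ _ _ (\bigcup_n ball n)).
  apply: subset_card_le => v _; have [s vs <-] := conn v0 v.
  by exists (size s) => //; exact: (inb s 0%N).
by apply: bigcup_countable => // n _; exact: finite_set_countable.
Qed.

Theorem theorem5p3 (R : realType) (V : choiceType) (E le : rel V)
    (hconn : graph_connected E) (hfin : locally_finite_graph E)
    (hchordal : chordal E) (htree : tree_order le) (hleft : left_handed E le)
    (p : V -> R) (hp : in_unit_cube p) :
  ((exists mu : probability (config V) R,
      one_dependent_laws E p mu /\ shearer_law E p mu) <-> equal_region E le p)
  /\
  (forall c : V -> R, in_unit_cube c -> equal_correspondence E le c p ->
   forall (d : measure_display) (T : measurableType d) (P : probability T R)
     (Y : V -> {mfun T >-> bool}),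
     mutually_independent P (fun v => Y v : T -> bool) ->
     (forall v, P [set t | Y v t] = (c v)%:E) ->
     let X : T -> config V := field_of E le (fun v => Y v : T -> bool) in
     measurable_fun [set: T] X /\ shearer_law E p (pushforward P X)).
Proof.
have [[Es Ei] _] := hchordal.
split; last first.
  move=> c c01 cp d T P Y Yind Yc X; split; first exact: measurable_field_of.
  have [mu [<- mu1]] := law_of_field Es hfin htree hleft Yind Yc cp.
  exact: shearer_law_of_ones.
split=> [[mu [_ mus]]|[_ [c [c01 cp]]]].
  apply: equal_region_of_finite => // W.
  by apply: exists_correspondence_on => // T; exact: indep_poly_ge0 mus.
have [d [T [P [Y [Yind Yc]]]]] :=
  exists_independent_bits (countable_vertices hconn hfin) c01.
have [mu [_ mu1]] := law_of_field Es hfin htree hleft Yind Yc cp.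
exists mu; split; last exact: shearer_law_of_ones.
split=> [|v]; first exact: one_dependent_of_ones.
(* The marginal at [v] is the all-ones probability of the singleton, which is independent because
   there are no loops. *)
have := mu1 [fset v]%fset; rewrite /ones_weight ifT; last first.
  by apply/allrelP => x y; rewrite !inE => /eqP -> /eqP ->; rewrite Ei.
rewrite big_seq_fset1 => <-; congr (mu _).
by rewrite -(fsetU0 [fset v]%fset) all_onesU1 all_ones0 setTI.
Qed.
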